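(* Let $\{g^k_j\mid 0\le j\le k\}_{k\in\mathbb{N}_0}$ be the system of quaternion valued polynomials on $\mathbb{R}^3$ uniquely determined by the conditions (i), (ii), (iii) listed in the context, and let $\{A^l_n\mid 0\le l\le n\}_{n\in\mathbb{N}_0}$ be the system of quaternion valued polynomials defined, with $y=y_0+i_1y_1+i_2y_2$ and $\overline{y}=y_0-i_1y_1-i_2y_2$, by $$A^l_l=(y_1-i_3y_2)^l,\qquad A^l_{l+1}=\tfrac14\left[(2l+3)y+(2l+1)\overline{y}\right]A^l_l\qquad(l\ge0),$$ $$A^l_{n+1}=\frac{n+1}{2(n-l+1)(n+l+2)}\left[\left((2n+3)y+(2n+1)\overline{y}\right)A^l_n-2n\,y\overline{y}\,A^l_{n-1}\right]\qquad(n\ge l+1).$$ Then $g^k_j=A^{k-j}_k$ for all $k\in\mathbb{N}_0$ and $j=0,\ldots,k$.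
   Context: $\mathbb{H}$ is the skew field of real quaternions $q=q_0+q_1i_1+q_2i_2+q_3i_3$ with $i_1^2=i_2^2=i_3^2=i_1i_2i_3=-1$, realized as the algebra of complex $2\times2$ matrices $$q=\begin{pmatrix}q_0+iq_3&-q_2+iq_1\\ q_2+iq_1&q_0-iq_3\end{pmatrix},\quad i_1=\begin{pmatrix}0&i\\ i&0\end{pmatrix},\ i_2=\begin{pmatrix}0&-1\\1&0\end{pmatrix},\ i_3=\begin{pmatrix}i&0\\0&-i\end{pmatrix}.$$ The variable in $\mathbb{R}^3$ is $(y_0,y_1,y_2)$ and $D=\frac{\partial}{\partial y_0}+i_1\frac{\partial}{\partial y_1}+i_2\frac{\partial}{\partial y_2}$. $\mathcal{M}_k(\mathbb{R}^3,\mathbb{H})$ is the space of $\mathbb{H}$-valued $k$-homogeneous polynomials $Q$ on $\mathbb{R}^3$ with $DQ=0$, regarded as a right $\mathbb{H}$-linear space. The conditions determining the polynomials $g^k_j\in\mathcal{M}_k(\mathbb{R}^3,\mathbb{H})$, $k\in\mathbb{N}_0$, $0\le j\le k$, are: (i) If $h^k_j$ and $h^k_{2k+1-j}$ denote the first and second column of the matrix valued polynomial $g^k_j$ ($j=0,\dots,k$), then $Hh^k_j=(k+\frac12-j)h^k_j$ for all $j=0,\dots,2k+1$, where $H=-i\left(\frac{i_3}2+y_2\frac{\partial}{\partial y_1}-y_1\frac{\partial}{\partial y_2}\right)$ (with $i_3$ acting on columns by matrix multiplication). (ii) $\frac{\partial g^k_j}{\partial y_0}=k\,g^{k-1}_{j-1}$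 for $j=1,\dots,k$ and $\frac{\partial g^k_0}{\partial y_0}=0$. (iii) $g^k_0=(y_1-i_3y_2)^k$ for each $k\in\mathbb{N}_0$. There exists exactly one such system. *)

(* Defs.v *)
From HB Require Import structures.
From mathcomp Require Import all_boot all_order all_algebra.
From mathcomp Require Import reals.
From mathcomp.real_closed Require Import complex.
From mathcomp Require Import mpoly.

Set Implicit Arguments.
Unset Strict Implicit.
Unset Printing Implicit Defensive.

Import Order.TTheory GRing.Theory Num.Theory.

Local Open Scope ring_scope.
Local Open Scope complex_scope.

Definition mx2 (T : nmodType) (a b c d : T) : 'M[T]_2 :=
  \matrix_(i < 2, j < 2) nth 0 (nth [::] [:: [:: a; b]; [:: c; d]] i) j.

(* The quaternion q0 + q1 i1 + q2 i2 + q3 i3 in its realization as a complex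
   2 x 2 matrix; (x +i* y) is the complex number x + i y. *)
Definition quat (R : realType) (q0 q1 q2 q3 : R) : 'M[R[i]]_2 :=
  mx2 (q0 +i* q3) (- q2 +i* q1)
      (q2 +i* q1) (q0 +i* - q3).

Definition is_quat (R : realType) (q : 'M[R[i]]_2) : Prop :=
  exists q0 q1 q2 q3 : R, q = quat q0 q1 q2 q3.

(* Complex polynomials in the three real variables (y_0, y_1, y_2). *)
Notation cpoly R := {mpoly (complex R)[3]}.

(* Matrix valued polynomials on R^3, as matrices of polynomials. *)
Notation mxpoly3 R := 'M[cpoly R]_2.

(* A matrix valued polynomial is quaternion valued if its values at all points
   of R^3 lie in the algebra of quaternions. *)
Definition quat_valued (R : realType) (Q : mxpoly3 R) : Prop :=
  forall y : 'I_3 -> R, is_quat (map_mx (meval (fun i => (y i)%:C)) Q).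

Definition cst_mx (R : realType) (q : 'M[R[i]]_2) : mxpoly3 R :=
  map_mx (@mpolyC 3 R[i]) q.

Definition i1 (R : realType) : mxpoly3 R := cst_mx (quat 0 1 0 0).
Definition i2 (R : realType) : mxpoly3 R := cst_mx (quat 0 0 1 0).
Definition i3 (R : realType) : mxpoly3 R := cst_mx (quat 0 0 0 1).

Definition idx0 : 'I_3 := @Ordinal 3 0 isT.
Definition idx1 : 'I_3 := @Ordinal 3 1 isT.
Definition idx2 : 'I_3 := @Ordinal 3 2 isT.

Definition y0 (R : realType) : cpoly R := 'X_idx0.
Definition y1 (R : realType) : cpoly R := 'X_idx1.
Definition y2 (R : realType) : cpoly R := 'X_idx2.

Definition pderiv (R : realType) (m n : nat) (i : 'I_3)
    (Q : 'M[cpoly R]_(m, n)) : 'M[cpoly R]_(m, n) :=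
  map_mx (mderiv i) Q.

Definition Dop (R : realType) (Q : mxpoly3 R) : mxpoly3 R :=
  pderiv idx0 Q + i1 R * pderiv idx1 Q + i2 R * pderiv idx2 Q.

(* The space M_k(R^3, H); the zero polynomial is k-homogeneous for all k. *)
Definition monogenic_homog (R : realType) (k : nat) (Q : mxpoly3 R) : Prop :=
  [/\ quat_valued Q, (forall a b, Q a b \is k.-homog) & Dop Q = 0].

(* H = - i (i3 / 2 + y_2 d/dy_1 - y_1 d/dy_2) on C^2-valued polynomials. *)
Definition Hop (R : realType) (h : 'cV[cpoly R]_2) : 'cV[cpoly R]_2 :=
  (- 'i%C)%:MP *: ((2%:R^-1)%:MP *: (i3 R *m h)
                   + y2 R *: pderiv idx1 h - y1 R *: pderiv idx2 h).

(* h^k_j for 0 <= j <= 2k+1: the first column of g^k_j if j <= k, and the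
   second column of g^k_(2k+1-j) if j > k. *)
Definition hcol (R : realType) (g : nat -> nat -> mxpoly3 R) (k j : nat) :
    'cV[cpoly R]_2 :=
  if (j <= k)%N then col ord0 (g k j) else col ord_max (g k (k.*2.+1 - j)%N).

Definition zeta (R : realType) : mxpoly3 R := (y1 R)%:M - i3 R * (y2 R)%:M.

(* The system is indexed by all pairs (k, j), written g k j for g^k_j, but only
   the entries with j <= k are constrained. *)
Definition g_system (R : realType) (g : nat -> nat -> mxpoly3 R) : Prop :=
  [/\ forall k j : nat, (j <= k)%N -> monogenic_homog k (g k j),
      forall k j : nat, (j <= k.*2.+1)%N ->
        Hop (hcol g k j) = (k%:R + 2%:R^-1 - j%:R)%:MP *: hcol g k j,
      forall k j : nat, (1 <= j <= k)%N ->
        pderiv idx0 (g k j) = k%:R *: g k.-1 j.-1,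
      forall k : nat, pderiv idx0 (g k 0%N) = 0
    & forall k : nat, g k 0%N = zeta R ^+ k].

Definition yvar (R : realType) : mxpoly3 R :=
  (y0 R)%:M + i1 R * (y1 R)%:M + i2 R * (y2 R)%:M.

Definition ybar (R : realType) : mxpoly3 R :=
  (y0 R)%:M - i1 R * (y1 R)%:M - i2 R * (y2 R)%:M.

(* Ashift l m = A^l_(l+m); see A_diag, A_first and A_next for the recursion in
   terms of A. *)
Fixpoint Ashift (R : realType) (l m : nat) : mxpoly3 R :=
  match m with
  | 0 => zeta R ^+ l
  | m1.+1 =>
    match m1 with
    | 0 =>
      (4%:R^-1)%:MP *:
        (((2 * l + 3)%:R *: yvar R + (2 * l + 1)%:R *: ybar R) * Ashift R l m1)
    | m2.+1 =>
      let n := (l + m1)%N in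
      ((n + 1)%:R / (2 * (n - l + 1) * (n + l + 2))%:R)%:MP *:
        (((2 * n + 3)%:R *: yvar R + (2 * n + 1)%:R *: ybar R) * Ashift R l m1
         - (2 * n)%:R *: (yvar R * ybar R * Ashift R l m2))
    end
  end.

(* A R l n = A^l_n, meaningful for l <= n. *)
Definition A (R : realType) (l n : nat) : mxpoly3 R := Ashift R l (n - l).

Lemma A_diag (R : realType) (l : nat) : A R l l = zeta R ^+ l.
Proof. by rewrite /A subnn. Qed.

Lemma A_first (R : realType) (l : nat) :
  A R l l.+1 =
  (4%:R^-1)%:MP *:
    (((2 * l + 3)%:R *: yvar R + (2 * l + 1)%:R *: ybar R) * A R l l).
Proof. by rewrite /A subnn subSnn. Qed.

Lemma A_next (R : realType) (l n : nat) : (l + 1 <= n)%N ->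
  A R l n.+1 =
  ((n + 1)%:R / (2 * (n - l + 1) * (n + l + 2))%:R)%:MP *:
    (((2 * n + 3)%:R *: yvar R + (2 * n + 1)%:R *: ybar R) * A R l n
     - (2 * n)%:R *: (yvar R * ybar R * A R l n.-1)).
Proof.
rewrite addn1 => lt_ln.
have [m ->] : exists m, n = (l + m.+1)%N.
  by exists (n - l.+1)%N; rewrite addnS -addSn subnKC.
have eS : ((l + m.+1).+1 - l = m.+2)%N by rewrite -addnS addKn.
have eP : ((l + m.+1).-1 - l = m)%N by rewrite addnS addKn.
rewrite /A eS eP.
have -> : Ashift R l (l + m.+1 - l) = Ashift R l m.+1 by rewrite addKn.
reflexivity.
Qed.

(* Main.v *)
Require Import Defs.
From mathcomp Require Import all_boot all_order all_algebra.
From mathcomp Require Import reals.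
From mathcomp.real_closed Require Import complex.
From mathcomp Require Import mpoly.
From mathcomp Require Import ring zify.

(** Write y = y_0 + v with v = i_1 y_1 + i_2 y_2, and let dirac be
    i_1 d/dy_1 + i_2 d/dy_2, so that D = d/dy_0 + dirac.  The proof shows that
    the recursively defined A satisfy the conditions that determine the g, and
    then that these conditions determine the g.

    The recursion reads c_n A_(n+1) = (n+1) T_n(A_n, A_(n-1)) for fixed l, with
    c_n = 2(n-l+1)(n+l+2) and
      T_n(B, B') = 4(n+1) y_0 B + 2 v B - 2n |y|^2 B',
    and it also covers A_(l+1) if A_(l-1) is read as 0.  Then:
    - H commutes with left multiplication by y_0, v and |y|^2, since it
      generates the rotations about the y_0 axis ([spin_vec]).  So the columns
      of A_n have the weights of the columns of the diagonal matrix zeta^l,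
      namely l + 1/2 and - l - 1/2 ([spin_recursion]).
    - With E the Euler operator, suppose that E A_n = n A_n,
      dA_n/dy_0 = n A_(n-1) and dirac A_n = - n A_(n-1), and likewise for n-1.
      The anticommutation rule
      dirac (v B) + v dirac B = -2 B - 2 (y_1 dB/dy_1 + y_2 dB/dy_2) and the
      product rule for y_1^2 + y_2^2 ([dirac_vec], [dirac_rho2]) give
        d/dy_0 T_n(A_n, A_(n-1)) = 4(n+1) A_n + n T_(n-1)(A_(n-1), A_(n-2)),
      where the last term is c_(n-1) A_n by the recursion, and dirac gives the
      opposite.  Since c_(n-1) + 4(n+1) = c_n, the three identities pass to
      n+1 ([appell_step], [appell_recursion]); in particular D A_(n+1) = 0.

    For uniqueness, by induction on k the difference P of g^k_j and A^(k-j)_k,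
    j >= 1, is independent of y_0.  A k-homogeneous D-null column independent
    of y_0 is made of a holomorphic and an antiholomorphic power, so its
    entries can only have the extreme weights k + 1/2 and - k - 1/2; the
    weights of the columns of P lie strictly between ([monogenic_spin_eq0]). *)

Set Implicit Arguments.
Unset Strict Implicit.
Unset Printing Implicit Defensive.

Import Order.TTheory GRing.Theory Num.Theory.
Local Open Scope ring_scope.

(** * Derivations *)

Record derivation (K : comNzRingType) := Derivation {
  der :> K -> K;
  derD : {morph der : a b / a + b};
  derM : forall a b, der (a * b) = der a * b + a * der b }.

Section Derivation.
Variables (K : comNzRingType) (d : derivation K).

Lemma der0 : d 0 = 0.
Proof. by apply: (addrI (d 0)); rewrite -derD !addr0. Qed.

Lemma derN a : d (- a) = - d a.
Proof. by apply: (addrI (d a)); rewrite -derD !subrr der0. Qed.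

Lemma derB a b : d (a - b) = d a - d b.
Proof. by rewrite derD derN. Qed.

Lemma der1 : d 1 = 0.
Proof.
have := derM d 1 1; rewrite !mulr1 mul1r => h.
by apply: (addrI (d 1)); rewrite -h addr0.
Qed.

Lemma der_nat n : d n%:R = 0.
Proof. by elim: n => [|n IH]; rewrite ?der0 // -natr1 derD IH der1 addr0. Qed.

Lemma der_exp a n : d (a ^+ n.+1) = n.+1%:R * (a ^+ n * d a).
Proof.
elim: n => [|n IH]; first by rewrite expr1 expr0 !mul1r.
by rewrite exprS derM IH -[n.+2]add1n natrD !exprS; ring.
Qed.
End Derivation.

(** * A ring with the differential calculus of three coordinates *)

(** The part of the structure of C[y_0, y_1, y_2] on which the computations rest:
    the coordinates with their partial derivatives, the imaginary unit and one
    half.  Nonzero integer factors can be cancelled, as the characteristic is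
    zero and there are no zero divisors. *)
Record spin_calculus := SpinCalculus {
  ring_of :> idomainType;
  nat_neq0 : forall n, n.+1%:R != 0 :> ring_of;
  im : ring_of;
  one_half : ring_of;
  x0 : ring_of;
  x1 : ring_of;
  x2 : ring_of;
  d0 : derivation ring_of;
  d1 : derivation ring_of;
  d2 : derivation ring_of;
  im_sqr : im * im = - 1;
  half_half : one_half + one_half = 1;
  d_im : [/\ d0 im = 0, d1 im = 0 & d2 im = 0];
  d_x0 : [/\ d0 x0 = 1, d1 x0 = 0 & d2 x0 = 0];
  d_x1 : [/\ d0 x1 = 0, d1 x1 = 1 & d2 x1 = 0];
  d_x2 : [/\ d0 x2 = 0, d1 x2 = 0 & d2 x2 = 1] }.

(** * Matrices with two rows or two columns *)

Lemma mul_mx2 (T : comNzRingType) n (a b c d : T) (Q : 'M[T]_(2, n)) :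
  forall j, ((mx2 a b c d *m Q) ord0 j = a * Q ord0 j + b * Q ord_max j)
         * ((mx2 a b c d *m Q) ord_max j = c * Q ord0 j + d * Q ord_max j).
Proof.
have e : lift ord0 ord0 = ord_max :> 'I_2 by apply: val_inj.
by move=> j; split; rewrite mxE big_ord_recl big_ord1 e !mxE.
Qed.

Lemma rowsP (T : Type) n (P Q : 'M[T]_(2, n)) :
  (forall j, (P ord0 j = Q ord0 j) * (P ord_max j = Q ord_max j)) -> P = Q.
Proof.
move=> h; apply/matrixP => -[[|[|//]] hi] j.
  by rewrite (_ : Ordinal hi = ord0) ?h //; apply: val_inj.
by rewrite (_ : Ordinal hi = ord_max) ?h //; apply: val_inj.
Qed.

Lemma colsP (T : Type) m (P Q : 'M[T]_(m, 2)) :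
  (forall i, (P i ord0 = Q i ord0) * (P i ord_max = Q i ord_max)) -> P = Q.
Proof.
move=> h; apply: trmx_inj; apply: rowsP => j; rewrite !mxE.
by split; rewrite h.
Qed.

Lemma mx2_ext (T : Type) (P Q : 'M[T]_2) :
  P ord0 ord0 = Q ord0 ord0 -> P ord0 ord_max = Q ord0 ord_max ->
  P ord_max ord0 = Q ord_max ord0 -> P ord_max ord_max = Q ord_max ord_max ->
  P = Q.
Proof.
move=> h1 h2 h3 h4; apply: rowsP => -[[|[|//]] hj].
  by rewrite (_ : Ordinal hj = ord0) ?h1 ?h3 //; apply: val_inj.
by rewrite (_ : Ordinal hj = ord_max) ?h2 ?h4 //; apply: val_inj.
Qed.

(** * The operators dirac, H and E *)

Section Calculus.
Variable K : spin_calculus.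
Local Notation im := (im K).
Local Notation half := (one_half K).
Local Notation x0 := (x0 K).
Local Notation x1 := (x1 K).
Local Notation x2 := (x2 K).
Local Notation d0 := (d0 K).
Local Notation d1 := (d1 K).
Local Notation d2 := (d2 K).

Implicit Types (k l m n p q : nat).

(** The matrix form of i_1 y_1 + i_2 y_2; its square is - rho2. *)
Definition vec : 'M[K]_2 := mx2 0 (im * x1 - x2) (im * x1 + x2) 0.
Definition rho2 : K := x1 ^+ 2 + x2 ^+ 2.

Definition dirac n (Q : 'M[K]_(2, n)) : 'M[K]_(2, n) :=
  mx2 0 im im 0 *m map_mx d1 Q + mx2 0 (-1) 1 0 *m map_mx d2 Q.

Definition euler m n (Q : 'M[K]_(m, n)) : 'M[K]_(m, n) :=
  x0 *: map_mx d0 Q + (x1 *: map_mx d1 Q + x2 *: map_mx d2 Q).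

(** The operator H for any number of columns: - i i_3 / 2 is the diagonal matrix
    with entries 1/2 and - 1/2, and - 1/2 is written half - 1 so that the
    commutation rules below are ring identities with an arbitrary half. *)
Definition spin n (Q : 'M[K]_(2, n)) : 'M[K]_(2, n) :=
  mx2 half 0 0 (half - 1) *m Q - im *: (x2 *: map_mx d1 Q - x1 *: map_mx d2 Q).

Lemma d_coord :
  ((d0 x0 = 1) * (d1 x0 = 0) * (d2 x0 = 0))
  * ((d0 x1 = 0) * (d1 x1 = 1) * (d2 x1 = 0))
  * ((d0 x2 = 0) * (d1 x2 = 0) * (d2 x2 = 1))
  * ((d0 im = 0) * (d1 im = 0) * (d2 im = 0)).
Proof.
by case: (d_im K) (d_x0 K) (d_x1 K) (d_x2 K)
  => ? ? ? [? ? ?] [? ? ?] [? ? ?].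
Qed.

Definition derE := (der_nat, der1, derM, derB, derD, derN, d_coord, expr2).

Lemma map_entryE m n (f : K -> K) (Q : 'M[K]_(m, n)) a b :
  map_mx f Q a b = f (Q a b).
Proof. by rewrite mxE. Qed.

Lemma addmxE m n (P Q : 'M[K]_(m, n)) a b : (P + Q) a b = P a b + Q a b.
Proof. by rewrite mxE. Qed.

Lemma oppmxE m n (P : 'M[K]_(m, n)) a b : (- P) a b = - P a b.
Proof. by rewrite mxE. Qed.

Lemma scalemxE m n x (P : 'M[K]_(m, n)) a b : (x *: P) a b = x * P a b.
Proof. by rewrite mxE. Qed.

Definition entryE := (addmxE, oppmxE, scalemxE, map_entryE).

Lemma vecE n (Q : 'M[K]_(2, n)) j :
  ((vec *m Q) ord0 j = (im * x1 - x2) * Q ord_max j)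
  * ((vec *m Q) ord_max j = (im * x1 + x2) * Q ord0 j).
Proof. by rewrite !mul_mx2 !mul0r add0r addr0. Qed.

Lemma diracE n (Q : 'M[K]_(2, n)) j :
  (dirac Q ord0 j = im * d1 (Q ord_max j) - d2 (Q ord_max j))
  * (dirac Q ord_max j = im * d1 (Q ord0 j) + d2 (Q ord0 j)).
Proof. by rewrite !addmxE !mul_mx2 !mxE; split; ring. Qed.

Lemma spinE n (Q : 'M[K]_(2, n)) j :
  (spin Q ord0 j = half * Q ord0 j
    - im * (x2 * d1 (Q ord0 j) - x1 * d2 (Q ord0 j)))
  * (spin Q ord_max j = (half - 1) * Q ord_max j
    - im * (x2 * d1 (Q ord_max j) - x1 * d2 (Q ord_max j))).
Proof. by rewrite !addmxE !mul_mx2 !mxE; split; ring. Qed.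

Lemma nat_gt0_neq0 n : (0 < n)%N -> n%:R != 0 :> K.
Proof. by case: n => // n _; exact: nat_neq0. Qed.

Lemma scalemx_inj m n (c : K) (P Q : 'M[K]_(m, n)) :
  c != 0 -> c *: P = c *: Q -> P = Q.
Proof.
move=> c_neq0 /matrixP e; apply/matrixP => i j; apply: (mulfI c_neq0).
by rewrite -!scalemxE e.
Qed.

(** This is v dirac + dirac v = -2 - 2 E' with E' the Euler operator of the
    plane: i_1 and i_2 anticommute and square to -1. *)
Lemma dirac_vec n (Q : 'M[K]_(2, n)) :
  dirac (vec *m Q) =
  - (2%:R *: Q + 2%:R *: (x1 *: map_mx d1 Q + x2 *: map_mx d2 Q))
  - vec *m dirac Q.
Proof.
apply: rowsP => j; rewrite !(diracE, vecE, entryE) !derE.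
by split; ring: (im_sqr K).
Qed.

Lemma dirac_rho2 n (Q : 'M[K]_(2, n)) :
  dirac (rho2 *: Q) = 2%:R *: (vec *m Q) + rho2 *: dirac Q.
Proof.
apply: rowsP => j; rewrite !(diracE, vecE, entryE) /rho2 !derE.
by split; ring: (im_sqr K).
Qed.

Lemma dirac_x0 n (Q : 'M[K]_(2, n)) : dirac (x0 *: Q) = x0 *: dirac Q.
Proof. by apply: rowsP => j; rewrite !(diracE, entryE) !derE; split; ring. Qed.

Lemma dirac_nat n m (Q : 'M[K]_(2, n)) : dirac (m%:R *: Q) = m%:R *: dirac Q.
Proof. by apply: rowsP => j; rewrite !(diracE, entryE) !derE; split; ring. Qed.

Lemma diracD n (P Q : 'M[K]_(2, n)) : dirac (P + Q) = dirac P + dirac Q.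
Proof. by apply: rowsP => j; rewrite !(diracE, entryE) !derE; split; ring. Qed.

Lemma diracB n (P Q : 'M[K]_(2, n)) : dirac (P - Q) = dirac P - dirac Q.
Proof. by apply: rowsP => j; rewrite !(diracE, entryE) !derE; split; ring. Qed.

(** H generates the rotations about the y_0 axis acting on spinors; the vector
    v is invariant under their joint action on coordinates and quaternions. *)
Lemma spin_vec n (Q : 'M[K]_(2, n)) : spin (vec *m Q) = vec *m spin Q.
Proof.
apply: rowsP => j; rewrite !(spinE, vecE, entryE) !derE.
by split; ring: (im_sqr K).
Qed.

Lemma spin_x0 n (Q : 'M[K]_(2, n)) : spin (x0 *: Q) = x0 *: spin Q.
Proof.
apply: rowsP => j; rewrite !(spinE, entryE) !derE.
by split; ring.
Qed.

Lemma spin_rho2 n (Q : 'M[K]_(2, n)) : spin (rho2 *: Q) = rho2 *: spin Q.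
Proof.
apply: rowsP => j; rewrite !(spinE, entryE) /rho2 !derE.
by split; ring.
Qed.

Lemma spin_nat n m (Q : 'M[K]_(2, n)) : spin (m%:R *: Q) = m%:R *: spin Q.
Proof.
apply: rowsP => j; rewrite !(spinE, entryE) !derE.
by split; ring.
Qed.

Lemma spinD n (P Q : 'M[K]_(2, n)) : spin (P + Q) = spin P + spin Q.
Proof. by apply: rowsP => j; rewrite !(spinE, entryE) !derE; split; ring. Qed.

Lemma spinB n (P Q : 'M[K]_(2, n)) : spin (P - Q) = spin P - spin Q.
Proof. by apply: rowsP => j; rewrite !(spinE, entryE) !derE; split; ring. Qed.

Lemma eulerE m n (Q : 'M[K]_(m, n)) i j : euler Q i j =
  x0 * d0 (Q i j) + (x1 * d1 (Q i j) + x2 * d2 (Q i j)).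
Proof. by rewrite !entryE. Qed.

Lemma eulerD m n (P Q : 'M[K]_(m, n)) : euler (P + Q) = euler P + euler Q.
Proof. by apply/matrixP => i j; rewrite !(eulerE, entryE) !derE; ring. Qed.

Lemma eulerB m n (P Q : 'M[K]_(m, n)) : euler (P - Q) = euler P - euler Q.
Proof. by apply/matrixP => i j; rewrite !(eulerE, entryE) !derE; ring. Qed.

Lemma euler_nat m p n (Q : 'M[K]_(m, p)) : euler (n%:R *: Q) = n%:R *: euler Q.
Proof. by apply/matrixP => i j; rewrite !(eulerE, entryE) !derE; ring. Qed.

Lemma euler_x0 m n (Q : 'M[K]_(m, n)) : euler (x0 *: Q) = x0 *: (Q + euler Q).
Proof. by apply/matrixP => i j; rewrite !(eulerE, entryE) !derE; ring. Qed.

Lemma euler_rho2 m n (Q : 'M[K]_(m, n)) :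
  euler (rho2 *: Q) = rho2 *: (2%:R *: Q + euler Q).
Proof. by apply/matrixP => i j; rewrite !(eulerE, entryE) /rho2 !derE; ring. Qed.

Lemma euler_vec n (Q : 'M[K]_(2, n)) :
  euler (vec *m Q) = vec *m (Q + euler Q).
Proof.
by apply: rowsP => j; rewrite !(eulerE, vecE, entryE) !derE; split; ring.
Qed.

Lemma d0_nat n m (Q : 'M[K]_(2, n)) : map_mx d0 (m%:R *: Q) = m%:R *: map_mx d0 Q.
Proof. by apply: rowsP => j; rewrite !entryE !derE; split; ring. Qed.

(** * The three-term recursion *)

(** With p = n + 1 and q = n this is
    ((2n+3) y + (2n+1) ybar) B - 2n y ybar B', since y ybar = y_0^2 + rho2.
    The two parameters are kept apart because one degree lower they are n and
    the truncated n - 1, and n = 0 occurs. *)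
Definition three_term p q n (B B' : 'M[K]_(2, n)) : 'M[K]_(2, n) :=
  (4 * p)%:R *: (x0 *: B) + 2%:R *: (vec *m B)
  - (2 * q)%:R *: ((x0 ^+ 2 + rho2) *: B').

Lemma scale_norm2 n (Q : 'M[K]_(2, n)) :
  (x0 ^+ 2 + rho2) *: Q = x0 *: (x0 *: Q) + rho2 *: Q.
Proof. by rewrite scalerDl expr2 scalerA. Qed.

Lemma spin_three_term p q n (B B' : 'M[K]_(2, n)) :
  spin (three_term p q B B') = three_term p q (spin B) (spin B').
Proof.
rewrite /three_term spinB spinD !spin_nat spin_x0 spin_vec.
by rewrite !scale_norm2 spinD spin_rho2 !spin_x0.
Qed.

Lemma three_term_mulr p q (B B' D : 'M[K]_2) :
  three_term p q (B *m D) (B' *m D) = three_term p q B B' *m D.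
Proof. by rewrite /three_term mulmxBl mulmxDl -!scalemxAl mulmxA. Qed.

Lemma euler_three_term k n (B B' : 'M[K]_(2, n)) :
  euler B = k%:R *: B -> euler B' = k.-1%:R *: B' ->
  euler (three_term k.+1 k B B') = k.+1%:R *: three_term k.+1 k B B'.
Proof.
move=> hB hB'; rewrite /three_term eulerB eulerD !euler_nat euler_vec.
rewrite !scale_norm2 eulerD euler_rho2 !euler_x0 hB hB'.
case: k {hB hB'} => [|k] /=.
  by apply: rowsP => j; rewrite !(vecE, entryE); split; ring.
by apply: rowsP => j; rewrite !(vecE, entryE) !natrM -!natr1; split; ring.
Qed.

(** The derivative reproduces the expression one degree lower, which is what
    makes the induction on the degree close up.  For k = 0 the truncated
    predecessor is harmless: its term carries the factor k. *)
Lemma d0_three_term k n (B B' B'' : 'M[K]_(2, n)) :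
  map_mx d0 B = k%:R *: B' -> map_mx d0 B' = k.-1%:R *: B'' ->
  map_mx d0 (three_term k.+1 k B B') =
  (4 * k.+1)%:R *: B + k%:R *: three_term k k.-1 B' B''.
Proof.
move=> hB hB'.
have eB i j : d0 (B i j) = k%:R * B' i j by rewrite -map_entryE hB scalemxE.
have eB' i j : d0 (B' i j) = k.-1%:R * B'' i j by rewrite -map_entryE hB' scalemxE.
apply: rowsP => j; rewrite /three_term !(vecE, entryE) /rho2 !derE !eB !eB'.
by rewrite !natrM -[k.+1%:R]natr1; split; ring.
Qed.

Lemma dirac_three_term k n (B B' B'' : 'M[K]_(2, n)) :
  euler B = k%:R *: B ->
  map_mx d0 B = k%:R *: B' -> dirac B = - (k%:R *: B') ->
  dirac B' = - (k.-1%:R *: B'') ->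
  dirac (three_term k.+1 k B B') =
  - ((4 * k.+1)%:R *: B + k%:R *: three_term k k.-1 B' B'').
Proof.
move=> eB hB DB DB'.
have e12 : x1 *: map_mx d1 B + x2 *: map_mx d2 B = k%:R *: B - x0 *: (k%:R *: B').
  by rewrite -eB -hB /euler [RHS]addrC addKr.
rewrite /three_term diracB diracD !dirac_nat dirac_x0 dirac_vec e12.
rewrite !scale_norm2 diracD dirac_rho2 !dirac_x0 DB DB'.
apply: rowsP => j; rewrite /three_term !(vecE, entryE) !natrM -[k.+1%:R]natr1.
by split; ring.
Qed.

(** Given the second condition, the third one says that D B = 0. *)
Definition appell k n (B' B : 'M[K]_(2, n)) :=
  [/\ euler B = k%:R *: B, map_mx d0 B = k%:R *: B' & dirac B = - (k%:R *: B')].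

(** The y_0 derivative of c B3 = (k+1) T_k(B2, B1) is
    (k+1) (4(k+1) B2 + k T_(k-1)(B1, B0)), and dirac gives the opposite; the
    recursion for B2 turns the bracket into (4(k+1) + c') B2 = c B2. *)
Lemma appell_step k c c' n (B0 B1 B2 B3 : 'M[K]_(2, n)) :
  (0 < c)%N -> c = (c' + 4 * k.+1)%N ->
  c%:R *: B3 = k.+1%:R *: three_term k.+1 k B2 B1 ->
  c'%:R *: B2 = k%:R *: three_term k k.-1 B1 B0 ->
  appell k B1 B2 -> appell k.-1 B0 B1 -> appell k.+1 B2 B3.
Proof.
move=> c_gt0 ec h3 h2 [e2 t2 s2] [e1 t1 s1].
have c_neq0 := nat_gt0_neq0 c_gt0.
have sum2 : (4 * k.+1)%:R *: B2 + k%:R *: three_term k k.-1 B1 B0 = c%:R *: B2.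
  by rewrite -h2 -scalerDl ec natrD addrC.
split; apply: (scalemx_inj c_neq0).
- rewrite -euler_nat h3 euler_nat euler_three_term //.
  by rewrite -h3 !scalerA mulrC.
- rewrite -d0_nat h3 d0_nat (d0_three_term t2 t1) sum2.
  by rewrite !scalerA mulrC.
- rewrite -dirac_nat h3 dirac_nat (dirac_three_term e2 t2 s2 s1) sum2.
  by rewrite !scalerN !scalerA mulrC.
Qed.

(** The power (y_1 - i_3 y_2)^l, which is diagonal because i_3 is. *)
Definition zeta_mx l : 'M[K]_2 :=
  mx2 ((x1 - im * x2) ^+ l) 0 0 ((x1 + im * x2) ^+ l).

(** The eigenvalues of H on the two columns of zeta^l: l + 1/2 and - l - 1/2. *)
Definition weights l : 'M[K]_2 := mx2 (l%:R + half) 0 0 (half - 1 - l%:R).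

Lemma mul_weights (P : 'M[K]_2) l i :
  ((P *m weights l) i ord0 = (l%:R + half) * P i ord0)
  * ((P *m weights l) i ord_max = (half - 1 - l%:R) * P i ord_max).
Proof.
have e : lift ord0 ord0 = ord_max :> 'I_2 by apply: val_inj.
by split; rewrite mxE big_ord_recl big_ord1 e !mxE /=; ring.
Qed.

Lemma zeta_mxE l :
  ((zeta_mx l ord0 ord0 = (x1 - im * x2) ^+ l) * (zeta_mx l ord0 ord_max = 0))
  * ((zeta_mx l ord_max ord0 = 0)
     * (zeta_mx l ord_max ord_max = (x1 + im * x2) ^+ l)).
Proof. by rewrite !mxE. Qed.

Lemma appell_zeta l : appell l 0 (zeta_mx l).
Proof.
split; apply: mx2_ext; rewrite !(diracE, eulerE, entryE) !zeta_mxE ?mxE.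
all: case: l => [|l]; rewrite ?expr0 ?der_exp ?derE ?der0 ?exprS; ring: (im_sqr K).
Qed.

Lemma spin_zeta l : spin (zeta_mx l) = zeta_mx l *m weights l.
Proof.
apply: mx2_ext; rewrite !(spinE, mul_weights) !zeta_mxE.
all: case: l => [|l]; rewrite ?expr0 ?der_exp ?derE ?der0 ?exprS -?natr1.
all: ring: (im_sqr K).
Qed.

Section Recursion.
Variables (l : nat) (F : nat -> 'M[K]_2).
Hypothesis F0 : F 0%N = zeta_mx l.

(** The value 0 below the first term makes the first step of the recursion an
    instance of the general one. *)
Definition pred_term m := if m is m'.+1 then F m' else 0.

(** With n = l + m the coefficient on the left is 2 (n-l+1) (n+l+2). *)
Hypothesis FS : forall m, (2 * (m + 1) * (2 * l + m + 2))%:R *: F m.+1 =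
  (l + m).+1%:R *: three_term (l + m).+1 (l + m) (F m) (pred_term m).

Lemma appell_recursion m : appell (l + m) (pred_term m) (F m).
Proof.
have start : appell (l + 0) (pred_term 0) (F 0%N).
  by rewrite addn0 F0; exact: appell_zeta.
have zero : appell (l + 0).-1 0 (0 : 'M[K]_2).
  by split; apply: rowsP => j;
    rewrite !(diracE, eulerE, entryE) ?mxE ?der0; split; ring.
(* One step below the first term both sides of the recursion vanish: its left
   coefficient is 0 there, and so are both arguments on the right. *)
have z0 : (2 * 0 * (2 * l + 0 + 1))%:R *: F 0%N =
    (l + 0)%:R *: three_term (l + 0) (l + 0).-1 (pred_term 0) 0.
  rewrite muln0 mul0n scale0r /three_term mulmx0 !scaler0 addr0 subrr.
  by rewrite scaler0.
elim/ltn_ind: m => -[|m] IH; first exact: start.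
have c_gt0 : (0 < 2 * (m + 1) * (2 * l + m + 2))%N by lia.
have c_rec : (2 * (m + 1) * (2 * l + m + 2) =
              2 * m * (2 * l + m + 1) + 4 * (l + m).+1)%N by lia.
have {c_gt0 c_rec} step B0 h2 h1 :=
  @appell_step _ _ _ _ B0 _ _ _ c_gt0 c_rec (FS m) h2 (IH m (ltnSn m)) h1.
rewrite addnS /=; case: m IH step => [|m] IH step.
  exact: (step 0 z0 zero).
have -> : F m.+1 = pred_term m.+2 by [].
apply: (step (pred_term m)) => //; last by rewrite addnS; apply: (IH m); lia.
rewrite [(l + m.+1)%N]addnS /= -FS; congr (_%:R *: _); lia.
Qed.

Lemma spin_recursion m : spin (F m) = F m *m weights l.
Proof.
elim/ltn_ind: m => -[|m] IH; first by rewrite F0 spin_zeta.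
have c_gt0 : (0 < 2 * (m + 1) * (2 * l + m + 2))%N by lia.
apply: (scalemx_inj (nat_gt0_neq0 c_gt0)).
rewrite -spin_nat FS spin_nat spin_three_term IH // scalemxAl FS -scalemxAl.
rewrite -three_term_mulr; congr (_ *: three_term _ _ _ _).
case: m IH {c_gt0} => [|m] IH /=; last by rewrite IH.
rewrite mul0mx; apply: rowsP => j; rewrite !spinE !mxE !der0; split; ring.
Qed.
End Recursion.

(** * Uniqueness *)

Lemma col_weights (P : 'M[K]_2) l :
  (col ord0 (P *m weights l) = (l%:R + half) *: col ord0 P)
  * (col ord_max (P *m weights l) = (half - 1 - l%:R) *: col ord_max P).
Proof.
by split; apply/matrixP => i j; rewrite mxE mul_weights scalemxE [col _ _ _ _]mxE.
Qed.

Lemma col_eq0 (P : 'M[K]_2) : col ord0 P = 0 -> col ord_max P = 0 -> P = 0.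
Proof.
move=> /matrixP h0 /matrixP h1; apply: colsP => i.
by have := h0 i ord0; have := h1 i ord0; rewrite !mxE.
Qed.

Lemma euler_col (Q : 'M[K]_2) c : euler (col c Q) = col c (euler Q).
Proof. by apply/matrixP => a b; rewrite [RHS]mxE !eulerE [col c Q _ _]mxE. Qed.

Lemma dirac_col (Q : 'M[K]_2) c : dirac (col c Q) = col c (dirac Q).
Proof.
apply: rowsP => b; rewrite ![col c (dirac Q) _ _]mxE.
by rewrite !diracE ![col c Q _ _]mxE.
Qed.

Lemma spin_col (Q : 'M[K]_2) c : spin (col c Q) = col c (spin Q).
Proof.
apply: rowsP => b; rewrite ![col c (spin Q) _ _]mxE.
by rewrite !spinE ![col c Q _ _]mxE.
Qed.

(** The entries u, v of h do not depend on y_0, so dirac h = 0 makes u a function of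
    y_1 - i y_2 and v one of y_1 + i y_2.  By homogeneity the rotation
    y_2 d/dy_1 - y_1 d/dy_2 multiplies u by i k and v by - i k, hence H
    multiplies u by k + 1/2 and v by - k - 1/2; the prescribed weight
    k + 1/2 - j is neither. *)
Lemma monogenic_spin_eq0 k j (h : 'cV[K]_2) :
  (0 < j < k.*2.+1)%N -> map_mx d0 h = 0 -> dirac h = 0 ->
  euler h = k%:R *: h -> spin h = (k%:R + half - j%:R) *: h -> h = 0.
Proof.
case/andP=> j_gt0 lt_j h0 Dh Eh Sh.
have entry (P Q : 'cV[K]_2) i : P = Q -> P i ord0 = Q i ord0 by move=> ->.
pose u := h ord0 ord0; pose v := h ord_max ord0.
have u0 : d0 u = 0 by move: (entry _ _ ord0 h0); rewrite !mxE.
have v0 : d0 v = 0 by move: (entry _ _ ord_max h0); rewrite !mxE.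
have Du : d2 u = - (im * d1 u).
  move: (entry _ _ ord_max Dh); rewrite diracE mxE => /eqP.
  by rewrite addrC addr_eq0 => /eqP.
have Dv : d2 v = im * d1 v.
  move: (entry _ _ ord0 Dh); rewrite diracE mxE => /eqP.
  by rewrite subr_eq0 => /eqP.
have Eu : (x1 - im * x2) * d1 u = k%:R * u.
  by move: (entry _ _ ord0 Eh); rewrite !entryE u0 Du => <-; ring.
have Ev : (x1 + im * x2) * d1 v = k%:R * v.
  by move: (entry _ _ ord_max Eh); rewrite !entryE v0 Dv => <-; ring.
have zero_sub (a b c : K) : a * b = c * b -> (c - a) * b = 0.
  by move=> e; rewrite mulrBl e subrr.
have u_eq0 : u = 0.
  apply: (mulfI (nat_gt0_neq0 j_gt0)); rewrite mulr0.
  move: (entry _ _ ord0 Sh); rewrite spinE scalemxE -/u Du.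
  have -> : half * u - im * (x2 * d1 u - x1 * - (im * d1 u)) =
      half * u + (x1 - im * x2) * d1 u by ring: (im_sqr K).
  rewrite Eu -mulrDl => /zero_sub.
  have -> : k%:R + half - j%:R - (half + k%:R) = - j%:R by ring.
  by rewrite mulNr => /eqP; rewrite oppr_eq0 => /eqP.
have v_eq0 : v = 0.
  have c_gt0 : (0 < k.*2.+1 - j)%N by rewrite subn_gt0.
  apply: (mulfI (nat_gt0_neq0 c_gt0)); rewrite mulr0.
  move: (entry _ _ ord_max Sh); rewrite spinE scalemxE -/v Dv.
  have -> : (half - 1) * v - im * (x2 * d1 v - x1 * (im * d1 v)) =
      (half - 1) * v - (x1 + im * x2) * d1 v by ring: (im_sqr K).
  rewrite Ev -mulrBl => /zero_sub.
  have -> : k%:R + half - j%:R - (half - 1 - k%:R) = (k.*2.+1 - j)%N%:R.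
    by rewrite natrB ?(ltnW lt_j) // -natr1 -muln2 natrM; ring.
  by [].
by apply: rowsP => i; rewrite ord1 !mxE.
Qed.

Section Uniqueness.
Variables (F g : nat -> nat -> 'M[K]_2).
Hypothesis F0 : forall l, F l 0%N = zeta_mx l.
Hypothesis FS : forall l m, (2 * (m + 1) * (2 * l + m + 2))%:R *: F l m.+1 =
  (l + m).+1%:R *:
    three_term (l + m).+1 (l + m) (F l m) (pred_term (F l) m).
Hypothesis g0 : forall k, g k 0%N = zeta_mx k.
Hypothesis gE : forall k j, (j <= k)%N -> euler (g k j) = k%:R *: g k j.
Hypothesis gD : forall k j, (j <= k)%N -> map_mx d0 (g k j) + dirac (g k j) = 0.
Hypothesis gA : forall k j, (j <= k)%N ->
  map_mx d0 (g k.+1 j.+1) = k.+1%:R *: g k j.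
Hypothesis gH0 : forall k j, (j <= k)%N ->
  spin (col ord0 (g k j)) = (k%:R + half - j%:R) *: col ord0 (g k j).
Hypothesis gH1 : forall k j, (j <= k)%N ->
  spin (col ord_max (g k j)) =
  (k%:R + half - (k.*2.+1 - j)%N%:R) *: col ord_max (g k j).

(** The two columns of the difference P have the indices j and 2k+1-j, which lie
    strictly between 0 and 2k+1 as soon as j >= 1. *)
Lemma system_unique k j : (j <= k)%N -> g k j = F (k - j) j.
Proof.
elim: k j => [|k IH] [|j] // le_jk; rewrite ?subn0; try by rewrite g0 F0.
have {}le_jk : (j <= k)%N by [].
rewrite subSS; set l := (k - j)%N.
have lj : (l + j.+1 = k.+1)%N by rewrite addnS subnK.
have [] := appell_recursion (F0 l) (FS l) j.+1; rewrite lj /= => FE FA FD.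
have FH := spin_recursion (F0 l) (FS l) j.+1.
apply/eqP; rewrite -subr_eq0; apply/eqP.
set P := _ - _.
have PE : euler P = k.+1%:R *: P by rewrite eulerB gE // FE scalerBr.
have PA : map_mx d0 P = 0.
  have -> : map_mx d0 P = map_mx d0 (g k.+1 j.+1) - map_mx d0 (F l j.+1).
    by apply/matrixP => a b; rewrite !entryE derB.
  by rewrite gA // FA IH // subrr.
have PD : dirac P = 0.
  have Dg : dirac (g k.+1 j.+1) = - map_mx d0 (g k.+1 j.+1).
    by apply/eqP; rewrite -addr_eq0 addrC gD.
  by rewrite diracB FD Dg gA // IH // subrr.
have PS c J : (0 < J < k.+1.*2.+1)%N ->
    spin (col c P) = (k.+1%:R + half - J%:R) *: col c P -> col c P = 0.
  move=> J_range; apply: (monogenic_spin_eq0 J_range).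
  - by apply/matrixP => a b; move/matrixP/(_ a c): PA; rewrite !mxE.
  - by rewrite dirac_col PD; apply/matrixP => a b; rewrite !mxE.
  - by rewrite euler_col PE; apply/matrixP => a b; rewrite !mxE.
have l_nat : l%:R = k%:R - j%:R :> K by rewrite natrB.
have spinP c (w : K) : spin (col c (g k.+1 j.+1)) = w *: col c (g k.+1 j.+1) ->
    spin (col c (F l j.+1)) = w *: col c (F l j.+1) ->
    spin (col c P) = w *: col c P.
  have -> : col c P = col c (g k.+1 j.+1) - col c (F l j.+1).
    by apply/matrixP => a b; rewrite !mxE.
  by move=> hg hF; rewrite spinB hg hF scalerBr.
apply: col_eq0.
  apply: (PS _ j.+1); first by lia.
  apply: spinP; first exact: gH0.
  by rewrite spin_col FH col_weights l_nat -!natr1; congr (_ *: _); ring.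
apply: (PS _ (k.+1.*2.+1 - j.+1)%N); first by lia.
apply: spinP; first exact: gH1.
rewrite spin_col FH col_weights l_nat natrB; last by lia.
by congr (_ *: _); rewrite -[k.+1.*2.+1]addn1 -muln2 natrD natrM -!natr1; ring.
Qed.
End Uniqueness.

(** * Quaternion expressions as 2 x 2 matrices *)

Local Notation I1 := (mx2 0 im im 0).
Local Notation I2 := (mx2 0 (- 1) 1 0).
Local Notation I3 := (mx2 im 0 0 (- im)).

Lemma mx2E (a b c d : K) :
  ((mx2 a b c d ord0 ord0 = a) * (mx2 a b c d ord0 ord_max = b))
  * ((mx2 a b c d ord_max ord0 = c) * (mx2 a b c d ord_max ord_max = d)).
Proof. by rewrite !mxE. Qed.

Lemma mx2_scalarE (x : K) :
  (((x%:M : 'M[K]_2) ord0 ord0 = x) * ((x%:M : 'M[K]_2) ord0 ord_max = 0))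
  * (((x%:M : 'M[K]_2) ord_max ord0 = 0) * ((x%:M : 'M[K]_2) ord_max ord_max = x)).
Proof. by rewrite !mxE. Qed.

Definition entry2E := (mul_mx2, entryE, mx2E, mx2_scalarE).

Lemma coord_sumE : x0%:M + I1 *m x1%:M + I2 *m x2%:M = x0%:M + vec.
Proof. by apply: mx2_ext; rewrite !entry2E; ring. Qed.

Lemma coord_conjE : x0%:M - I1 *m x1%:M - I2 *m x2%:M = x0%:M - vec.
Proof. by apply: mx2_ext; rewrite !entry2E; ring. Qed.

Lemma norm2E : (x0%:M + vec) *m (x0%:M - vec) = (x0 ^+ 2 + rho2)%:M.
Proof.
rewrite mulmxDl mul_scalar_mx; apply: mx2_ext.
all: by rewrite !(vecE, entryE) /vec !(mx2E, mx2_scalarE) /rho2; ring: (im_sqr K).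
Qed.

Lemma zetaE l : (x1%:M - I3 *m x2%:M) ^+ l = zeta_mx l.
Proof.
elim: l => [|l IH].
  rewrite expr0 -[1]/(1%:M).
  by apply: mx2_ext; rewrite zeta_mxE ?expr0 mx2_scalarE.
rewrite exprS IH -mulmxE.
have -> : x1%:M - I3 *m x2%:M = mx2 (x1 - im * x2) 0 0 (x1 + im * x2).
  by apply: mx2_ext; rewrite !entry2E; ring.
by apply: mx2_ext; rewrite !(zeta_mxE, entry2E) ?exprS; ring.
Qed.

Lemma spinE_I3 (h : 'cV[K]_2) :
  (- im) *: (half *: (I3 *m h) + x2 *: map_mx d1 h - x1 *: map_mx d2 h)
  = spin h.
Proof.
apply: rowsP => j; rewrite !(spinE, entry2E) -(half_half K).
by split; ring: (im_sqr K).
Qed.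

Lemma three_termE n (B B' : 'M[K]_2) :
  ((2 * n + 3)%:R *: (x0%:M + vec) + (2 * n + 1)%:R *: (x0%:M - vec)) *m B
  - (2 * n)%:R *: ((x0 ^+ 2 + rho2)%:M *m B')
  = three_term n.+1 n B B'.
Proof.
rewrite mul_scalar_mx /three_term; congr (_ - _).
rewrite mulmxDl -!scalemxAl mulmxBl mulmxDl mul_scalar_mx.
by apply: rowsP => j; rewrite !(vecE, entryE) !(natrD, natrM) -natr1; split; ring.
Qed.

Lemma three_term_0 n (B : 'M[K]_2) :
  three_term n.+1 n B 0 =
  ((2 * n + 3)%:R *: (x0%:M + vec) + (2 * n + 1)%:R *: (x0%:M - vec)) *m B.
Proof. by rewrite -three_termE mulmx0 scaler0 subr0. Qed.

Lemma scalemx_quot (a c x : K) (P : 'M[K]_2) :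
  c * x = a -> c *: (x *: P) = a *: P.
Proof. by move=> <-; rewrite scalerA. Qed.

End Calculus.

(** * The polynomial ring on R^3 *)

Lemma homog_euler (S : comNzRingType) (n d : nat) (p : {mpoly S[n]}) :
  p \is d.-homog -> \sum_(i < n) 'X_i * p^`M(i) = d%:R * p.
Proof.
move=> /dhomogP hp; rewrite {2}[p]mpolyE mulr_sumr.
transitivity (\sum_(m <- msupp p) \sum_(i < n) 'X_i * (p@_m *: ('X_[m])^`M(i))).
  rewrite exchange_big /=; apply: eq_bigr => i _.
  rewrite {1}[p]mpolyE raddf_sum /= mulr_sumr.
  by apply: eq_bigr => m _; rewrite mderivZ.
rewrite big_seq [RHS]big_seq; apply: eq_bigr => m /hp dm.
rewrite -dm /= mdegE natr_sum mulr_suml; apply: eq_bigr => i _.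
rewrite mderivX.
have [mi0|mi0] := posnP (m i).
  by rewrite mi0 scale0r scaler0 mulr0 mul0r.
have XX : 'X_i * 'X_[m - U_(i)] = 'X_[m] :> {mpoly S[n]}.
  rewrite -mpolyXD addmC submK //.
  apply/mnm_lepP => j; rewrite mnm1E; case: eqP => // <-; lia.
by rewrite -!scalerAr XX scaler_nat mulr_natl.
Qed.

Section Poly.
Variable R : realType.
Local Notation C := (complex R).

Definition mderivation i := Derivation (@mderivD 3 C i) (@mderivM 3 C i).

Lemma mderiv_y (i j : 'I_3) : ('X_j : cpoly R)^`M(i) = (i == j)%:R.
Proof.
rewrite mderivX mnm1E eq_sym; case: eqP => [->|_]; last by rewrite scale0r.
rewrite scale1r (_ : (U_(j) - U_(j))%MM = 0%MM) ?mpolyX0 //.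
by apply/mnmP => k; rewrite mnmBE subnn mnm0E.
Qed.

Lemma mpoly_nat_neq0 n : n.+1%:R != 0 :> cpoly R.
Proof. by rewrite -mpolyC_nat mpolyC_eq0 pnatr_eq0. Qed.

Lemma imC_sqr : ('i%C)%:MP * ('i%C)%:MP = - 1 :> cpoly R.
Proof. by rewrite -mpolyCM -expr2 sqr_i mpolyCN mpolyC1. Qed.

Lemma half_halfC : (2%:R^-1)%:MP + (2%:R^-1)%:MP = 1 :> cpoly R.
Proof.
have e : 2%:R^-1 + 2%:R^-1 = 1 :> C.
  by rewrite [RHS]splitr div1r.
by rewrite -mpolyCD e mpolyC1.
Qed.

Definition poly_calculus : spin_calculus.
Proof.
refine (@SpinCalculus (cpoly R) mpoly_nat_neq0 ('i%C)%:MP (2%:R^-1)%:MP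
  (y0 R) (y1 R) (y2 R) (mderivation idx0) (mderivation idx1) (mderivation idx2)
  imC_sqr half_halfC _ _ _ _).
- by split; exact: mderivC.
- by split; exact: mderiv_y.
- by split; exact: mderiv_y.
- by split; exact: mderiv_y.
Defined.

Local Notation K := poly_calculus.

Lemma i1E : i1 R = mx2 0 (im K) (im K) 0.
Proof.
apply/matrixP => i j; rewrite !mxE.
case: i => -[|[|//]] ?; case: j => -[|[|//]] ? /=.
1,4: by rewrite ?oppr0 -[RHS](mpolyC0 3).
by rewrite oppr0.
by [].
Qed.

Lemma i2E : i2 R = mx2 0 (-1) 1 0.
Proof.
apply/matrixP => i j; rewrite !mxE.
case: i => -[|[|//]] ?; case: j => -[|[|//]] ? /=.
1,4: by rewrite ?oppr0 -[RHS](mpolyC0 3).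
by rewrite -(mpolyC1 3 C) -mpolyCN; congr (_%:MP); apply/eqP;
  rewrite eq_complex /= oppr0 !eqxx.
by rewrite -(mpolyC1 3 C).
Qed.

Lemma i3E : i3 R = mx2 (im K) 0 0 (- im K).
Proof.
apply/matrixP => i j; rewrite !mxE.
case: i => -[|[|//]] ?; case: j => -[|[|//]] ? /=.
by [].
1,2: by rewrite ?oppr0 -[RHS](mpolyC0 3).
by rewrite -mpolyCN; congr (_%:MP); apply/eqP;
  rewrite eq_complex /= oppr0 !eqxx.
Qed.

Lemma Dop_dirac (Q : mxpoly3 R) : Dop Q = map_mx (d0 K) Q + @dirac K 2 Q.
Proof. by rewrite /Dop -addrA i1E i2E. Qed.

Lemma Hop_spin (h : 'cV[cpoly R]_2) : Hop h = @spin K 1 h.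
Proof. by rewrite -(@spinE_I3 K) /Hop mpolyCN i3E. Qed.

Lemma zetaX l : zeta R ^+ l = zeta_mx K l.
Proof. by rewrite -(@zetaE K) /zeta i3E. Qed.

Lemma yvarE : yvar R = (x0 K)%:M + vec K.
Proof. by rewrite -(@coord_sumE K) /yvar i1E i2E. Qed.

Lemma ybarE : ybar R = (x0 K)%:M - vec K.
Proof. by rewrite -(@coord_conjE K) /ybar i1E i2E. Qed.

Lemma nat_mul_quot a c : (0 < c)%N ->
  c%:R * (a%:R / c%:R)%:MP = a%:R :> cpoly R.
Proof.
move=> c_gt0; rewrite -!mpolyC_nat -mpolyCM mulrC divfK //.
by rewrite pnatr_eq0 -lt0n.
Qed.

Lemma Ashift_rec l m :
  (2 * (m + 1) * (2 * l + m + 2))%:R *: Ashift R l m.+1 =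
  (l + m).+1%:R *:
    @three_term K (l + m).+1 (l + m) 2 (Ashift R l m) (@pred_term K (Ashift R l) m).
Proof.
case: m => [|m].
  rewrite [(l + 0)%N]addn0 (@three_term_0 K) -yvarE -ybarE.
  apply: (@scalemx_quot K).
  have -> : (2 * (0 + 1) * (2 * l + 0 + 2) = l.+1 * 4)%N by lia.
  (* The first step has the coefficient 1/4, which is (l+1) / (2 (2l+2)). *)
  have := nat_mul_quot 1 (isT : (0 < 4)%N); rewrite div1r => quarter.
  by rewrite natrM -mulrA quarter mulr1.
rewrite -(@three_termE K) -(@norm2E K) -yvarE -ybarE.
apply: (@scalemx_quot K).
have -> : (2 * (m.+1 + 1) * (2 * l + m.+1 + 2) =
    2 * (l + m.+1 - l + 1) * (l + m.+1 + l + 2))%N by lia.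
by rewrite -[(l + m.+1).+1]addn1; apply: nat_mul_quot; lia.
Qed.

Lemma sum_idx (V : nmodType) (f : 'I_3 -> V) :
  \sum_i f i = f idx0 + (f idx1 + f idx2).
Proof.
rewrite !big_ord_recl big_ord0 addr0.
by congr (f _ + (f _ + f _)); apply: val_inj.
Qed.

Lemma euler_homog k (Q : mxpoly3 R) :
  (forall a b, Q a b \is k.-homog) -> @euler K 2 2 Q = k%:R *: Q.
Proof.
move=> hQ; apply/matrixP => a b.
by rewrite eulerE [RHS]mxE -(homog_euler (hQ a b)) sum_idx.
Qed.
End Poly.

Theorem mainTheorem8 (R : realType) (g : nat -> nat -> mxpoly3 R)
    (g_sys : g_system g) (k j : nat) (le_jk : (j <= k)%N) :
  g k j = A R (k - j) k.
Proof.
case: g_sys => g_mono g_H g_d0 _ g_0.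
rewrite /A subKn //.
apply: (@system_unique (poly_calculus R) (Ashift R) g) => //.
- exact: zetaX.
- exact: Ashift_rec.
- by move=> n; rewrite g_0 zetaX.
- by move=> n m /g_mono[_ hom _]; exact: euler_homog.
- by move=> n m /g_mono[_ _]; rewrite Dop_dirac.
- by move=> n m le_mn; exact: (g_d0 n.+1 m.+1).
- move=> n m le_mn.
  have := g_H n m; rewrite /hcol le_mn Hop_spin => ->; last by lia.
  by rewrite mpolyCB mpolyCD !mpolyC_nat.
- move=> n m le_mn.
  have second : (n.*2.+1 - m <= n)%N = false by lia.
  have := g_H n (n.*2.+1 - m)%N; rewrite /hcol second.
  have -> : (n.*2.+1 - (n.*2.+1 - m) = m)%N by lia.
  rewrite Hop_spin => ->; last by lia.
  by rewrite mpolyCB mpolyCD !mpolyC_nat.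
Qed.
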